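(* Let $V,T\ge 1$ be integers and let $\mathcal{X}=\mathbb{R}^{V\times T}$ be the space of $V$-variate time series of length $T$. Let $\mathcal{Q}$ be the finite index set of the ensemble, and for each $q\in\mathcal{Q}$ let $\Pi(q):\mathcal{X}\to\mathbb{R}^{q_2}$ be the posterior map of the $q$-th Gaussian mixture model, as defined in the context. Then the time series cluster kernel $$K:\mathcal{X}\times\mathcal{X}\to\mathbb{R},\qquad K(X,X')=\sum_{q\in\mathcal{Q}}\Pi(q)(X)^{T}\,\Pi(q)(X'),$$ is a kernel, i.e. there exist a real Hilbert space $\mathcal{H}$ and a map $\Phi:\mathcal{X}\to\mathcal{H}$ such that $K(X,X')=\langle\Phi(X),\Phi(X')\rangle_{\mathcal{H}}$ for all $X,X'\in\mathcal{X}$.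
   Context: Definition (kernel). For a non-empty set $\mathcal{X}$, a function $k:\mathcal{X}\times\mathcal{X}\to\mathbb{R}$ is a kernel if there exist a real Hilbert space $\mathcal{H}$ and a map $\Phi:\mathcal{X}\to\mathcal{H}$ with $k(x,y)=\langle\Phi(x),\Phi(y)\rangle_{\mathcal{H}}$ for all $x,y\in\mathcal{X}$. Data. An element $X\in\mathcal{X}$ has entries $x_v(t)$, $1\le v\le V$, $1\le t\le T$. Each $X$ comes with a binary mask $R=R_X\in\{0,1\}^{V\times T}$ with entries $r_v(t)$, where $r_v(t)=0$ if $x_v(t)$ is missing and $r_v(t)=1$ if it is observed ($R\equiv 1$ for completely observed data); the mask is suppressed in the notation. Ensemble. Fix integers $Q\ge 1$, $C\ge 2$ and $\mathcal{Q}=\{q=(q_1,q_2): q_1=1,\dots,Q,\ q_2=2,\dots,C\}$. For each $q\in\mathcal{Q}$ there are fixed (obtained in a training phase and then kept fixed): a set of attributes $\mathcal{V}(q)\subset\{1,\dots,V\}$, a time segment $\mathcal{T}(q)\subset\{1,\dots,T\}$, and parameters $\Theta(q)$ of a diagonal-covariance Gaussian mixture model with $q_2$ components, namely mixing weights $\theta_g\in[0,1]$ with $\sum_{g=1}^{q_2}\theta_g=1$, means $\mu_{gv}(t)\in\mathbb{R}$ and standard deviations $\sigma_{gv}>0$, for $1\le g\le q_2$, $v\in\mathcal{V}(q)$, $t\in\mathcal{T}(q)$. Posterior map. $\Pi(q)(X)=(\pi_1,\dots,\pi_{q_2})^{T}$, where $$\pi_g=\frac{\theta_g\prod_{v\in\mathcal{V}(q)}\prod_{t\in\mathcal{T}(q)}\mathcal{N}(x_v(t)\mid\mu_{gv}(t),\sigma_{gv})^{r_v(t)}}{\sum_{g'=1}^{q_2}\theta_{g'}\prod_{v\in\mathcal{V}(q)}\prod_{t\in\mathcal{T}(q)}\mathcal{N}(x_v(t)\mid\mu_{g'v}(t),\sigma_{g'v})^{r_v(t)}}$$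 and $\mathcal{N}(\cdot\mid\mu,\sigma)$ is the univariate normal density with mean $\mu$ and standard deviation $\sigma$. *)

(* Defs.v *)
From mathcomp Require Import all_boot all_order all_algebra sesquilinear.
From mathcomp Require Import all_classical all_reals all_analysis.

Set Implicit Arguments.
Unset Strict Implicit.
Unset Printing Implicit Defensive.

Import Order.TTheory GRing.Theory Num.Theory.
Import numFieldNormedType.Exports.

Local Open Scope ring_scope.

(* Positive definiteness, symmetry and bilinearity of the inner product are
   part of [{dot _ for idfun}]; completeness is with respect to the norm that
   it induces. *)
Record hilbertSpace (R : realType) := HilbertSpace {
  hilbert_sort :> completeNormedModType R;
  inner : {dot hilbert_sort for idfun};
  inner_norm : forall u : hilbert_sort, `|u| ^+ 2 = inner u u
}.

Definition is_kernel (R : realType) (X : Type) (k : X -> X -> R) : Prop :=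
  exists (H : hilbertSpace R) (Phi : X -> H),
    forall x y : X, k x y = inner H (Phi x) (Phi y).

(* The pairs q = (q_1, q_2) with 1 <= q_1 <= Q and 2 <= q_2 <= C. *)
Notation ens_index Q C :=
  {q : 'I_Q.+1 * 'I_C.+1 | (1 <= q.1)%N && (2 <= q.2)%N}.

Definition ncomp (Q C : nat) (q : ens_index Q C) : nat := (val q).2.

(* Means and standard deviations are total functions; only their values on the
   attributes in [A] and the times in [S] are constrained or used. *)
Record gmm (R : realType) (V T : nat) (A : {set 'I_V}) (S : {set 'I_T})
    (G : nat) := GMM {
  weight : 'I_G -> R;
  mean : 'I_G -> 'I_V -> 'I_T -> R;
  sdev : 'I_G -> 'I_V -> R;
  weight_itv : forall g, 0 <= weight g <= 1;
  weight_sum : \sum_g weight g = 1;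
  sdev_gt0 : forall g v, v \in A -> 0 < sdev g v
}.

(* Attributes and times are numbered from 0. *)
Definition is_segment (T : nat) (S : {set 'I_T}) : Prop :=
  exists a b : nat, S = [set t : 'I_T | (a <= t <= b)%N].

Record ensemble (R : realType) (V T Q C : nat) := Ensemble {
  attributes : ens_index Q C -> {set 'I_V};
  segment : ens_index Q C -> {set 'I_T};
  segmentP : forall q, is_segment (segment q);
  model : forall q, gmm R (attributes q) (segment q) (ncomp q)
}.

Section Posterior.
Variables (R : realType) (V T : nat).

(* The exponent [r v t] is the mask entry, coerced from [bool] to 0 or 1. *)
Definition weighted_lik (A : {set 'I_V}) (S : {set 'I_T}) (G : nat)
    (m : gmm R A S G) (x : 'M[R]_(V, T)) (r : 'M[bool]_(V, T)) (g : 'I_G) : R :=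
  weight m g *
  \prod_(v in A) \prod_(t in S)
    normal_pdf (mean m g v t) (sdev m g v) (x v t) ^+ r v t.

Definition posterior (A : {set 'I_V}) (S : {set 'I_T}) (G : nat)
    (m : gmm R A S G) (x : 'M[R]_(V, T)) (r : 'M[bool]_(V, T)) : 'cV[R]_G :=
  \col_g (weighted_lik m x r g / \sum_g' weighted_lik m x r g').

(* [mask X] is the mask R_X that comes with the time series [X]. *)
Definition Pi (Q C : nat) (e : ensemble R V T Q C)
    (mask : 'M[R]_(V, T) -> 'M[bool]_(V, T)) (q : ens_index Q C)
    (X : 'M[R]_(V, T)) : 'cV[R]_(ncomp q) :=
  posterior (model e q) X (mask X).

Definition tck (Q C : nat) (e : ensemble R V T Q C)
    (mask : 'M[R]_(V, T) -> 'M[bool]_(V, T)) (X X' : 'M[R]_(V, T)) : R :=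
  \sum_(q : ens_index Q C) ((Pi e mask q X)^T *m Pi e mask q X') 0 0.

End Posterior.

(* Main.v *)
Require Import Defs.
From mathcomp Require Import all_boot all_order all_algebra sesquilinear.
From mathcomp Require Import all_classical all_reals all_analysis.
From HB Require Import structures.
From mathcomp Require Import ring lra.

(** The feature map stacks the posteriors [Pi q X], for all [q], into one vector
    of a Euclidean space. That space is rebuilt with its 2-norm, since
    the library norms matrices by the supremum, which no inner product induces. *)

Set Implicit Arguments.
Unset Strict Implicit.
Unset Printing Implicit Defensive.

Import Order.TTheory GRing.Theory Num.Theory.
Import numFieldNormedType.Exports.

Local Open Scope classical_set_scope.
Local Open Scope ring_scope.

(** A new name for the function space inherits its module structure alone, so that the norm and
    topology attached below are those of the dot product. *)
Definition euclidean (R : realType) (I : finType) : Type := {ffun I -> R^o}.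

HB.instance Definition _ (R : realType) (I : finType) :=
  GRing.Lmodule.on (euclidean R I).

Section Euclidean.
Variables (R : realType) (I : finType).
Implicit Types (x y : euclidean R I) (a : R) (i : I).

Lemma euclideanD x y i : (x + y : euclidean R I) i = x i + y i.
Proof. by rewrite ffunE. Qed.

Lemma euclideanZ a x i : (a *: x : euclidean R I) i = a * x i.
Proof. by rewrite ffunE. Qed.

Definition edot x y : R := \sum_i x i * y i.

Lemma edotC x y : edot x y = edot y x.
Proof. by apply: eq_bigr => i _; rewrite mulrC. Qed.

Lemma edotDZl a x y z : edot (a *: x + y) z = a * edot x z + edot y z.
Proof.
rewrite /edot mulr_sumr -big_split; apply: eq_bigr => i _ /=.
by rewrite euclideanD euclideanZ mulrDl mulrA.
Qed.

Lemma edotDZr a x y z : edot z (a *: x + y) = a * edot z x + edot z y.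
Proof. by rewrite !(edotC z) edotDZl. Qed.

Lemma edot_ge0 x : 0 <= edot x x.
Proof. by apply: sumr_ge0 => i _; rewrite -expr2 sqr_ge0. Qed.

Lemma edot_eq0 x : edot x x = 0 -> x = 0.
Proof.
move=> /psumr_eq0P x0; apply/ffunP => i; rewrite ffunE.
have /eqP := x0 (fun j _ => sqr_ge0 (x j)) i isT.
by rewrite mulf_eq0 orbb => /eqP.
Qed.

Definition enorm x : R := Num.sqrt (edot x x).

Lemma enorm_ge0 x : 0 <= enorm x.
Proof. exact: sqrtr_ge0. Qed.

Lemma sqr_enorm x : enorm x ^+ 2 = edot x x.
Proof. by rewrite sqr_sqrtr ?edot_ge0. Qed.

Lemma enorm_eq0 x : enorm x = 0 -> x = 0.
Proof. by move=> x0; apply: edot_eq0; rewrite -sqr_enorm x0 expr0n. Qed.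

Lemma enormZ a x : enorm (a *: x) = `|a| * enorm x.
Proof.
rewrite /enorm; have -> : edot (a *: x) (a *: x) = a ^+ 2 * edot x x.
  by rewrite /edot mulr_sumr; apply: eq_bigr => i _; rewrite euclideanZ; ring.
by rewrite sqrtrM ?sqr_ge0 // sqrtr_sqr.
Qed.

(** The scalar stays general for two uses: a projection coefficient in Cauchy-Schwarz, and 1 in the
    triangle inequality. *)
Lemma sqr_enormDZ a x y :
  enorm (a *: x + y) ^+ 2 =
  a ^+ 2 * enorm x ^+ 2 + a * edot x y *+ 2 + enorm y ^+ 2.
Proof. by rewrite !sqr_enorm edotDZl !edotDZr (edotC y x); ring. Qed.

Lemma edot_le_enorm x y : edot x y <= enorm x * enorm y.
Proof.
have [/enorm_eq0 -> | x0] := eqVneq (enorm x) 0.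
  rewrite /edot big1 ?mulr_ge0 ?enorm_ge0 // => i _.
  by rewrite ffunE mul0r.
(* Cauchy-Schwarz: the vector is [y] minus its orthogonal projection onto [x], and its squared norm
   is nonnegative. *)
have := sqr_ge0 (enorm ((- (edot x y / enorm x ^+ 2)) *: x + y)).
have -> : enorm ((- (edot x y / enorm x ^+ 2)) *: x + y) ^+ 2 =
          enorm y ^+ 2 - (edot x y / enorm x) ^+ 2.
  by rewrite sqr_enormDZ; field.
rewrite subr_ge0 => dot_sqr.
have x_gt0 : 0 < enorm x by rewrite lt_def x0 enorm_ge0.
rewrite mulrC -ler_pdivrMr //; apply: le_trans (ler_norm _) _.
by rewrite -(ler_pXn2r (n := 2)) ?nnegrE ?enorm_ge0 // real_normK ?num_real.
Qed.

Lemma enormD x y : enorm (x + y) <= enorm x + enorm y.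
Proof.
rewrite -(ler_pXn2r (n := 2)) ?nnegrE ?addr_ge0 ?enorm_ge0 //.
have := edot_le_enorm x y; have := sqr_enormDZ 1 x y; rewrite scale1r => -> ?.
nra.
Qed.

(** After squaring, the bound holds term by term, since each [|x i|] is at most the whole sum. It
    turns coordinatewise convergence into convergence in norm. *)
Lemma enorm_le_sum x : enorm x <= \sum_i `|x i|.
Proof.
rewrite -(ler_pXn2r (n := 2)) ?nnegrE ?enorm_ge0 ?sumr_ge0 //.
rewrite sqr_enorm expr2 mulr_suml; apply: ler_sum => i _.
rewrite -expr2 -real_normK ?num_real // expr2 ler_wpM2l //.
by rewrite (bigD1 i) //= lerDl sumr_ge0.
Qed.

Lemma coord_le_enorm x i : `|x i| <= enorm x.
Proof.
rewrite -sqrtr_sqr ler_wsqrtr // /edot (bigD1 i) //= expr2 lerDl.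
by apply: sumr_ge0 => j _; rewrite -expr2 sqr_ge0.
Qed.

HB.instance Definition _ := Lmodule_isNormed.Build R (euclidean R I)
  enormD enormZ enorm_eq0.

(** Coordinates are 1-Lipschitz, so a Cauchy filter is Cauchy in each of them with the same radius.
    Completeness of the reals gives the coordinates of the limit, and finiteness of [I] makes the
    convergence uniform over them. *)
Lemma euclidean_complete (F : set_system (euclidean R I)) :
  ProperFilter F -> cauchy F -> cvg F.
Proof.
move=> FF /cauchy_ballP Fc.
have cvgi i : cvg ((fun x : euclidean R I => x i : R^o) @ F).
  apply: cauchy_cvg; apply/cauchy_ballP => e e0.
  rewrite near_map2; apply: filterS (Fc e e0) => -[x y] /=.
  rewrite -!ball_normE /=; apply: le_lt_trans.
  by have := coord_le_enorm (x - y) i; rewrite !ffunE.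
pose l : euclidean R I :=
  [ffun i => lim ((fun x : euclidean R I => x i : R^o) @ F)].
apply/cvg_ex; exists l; apply/cvgrPdist_lt => e e0.
(* The successor keeps the divisor positive when [I] is empty, and makes the sum of [#|I|] such
   bounds strictly less than [e]. *)
have d0 : 0 < e / #|I|.+1%:R by rewrite divr_gt0.
near=> x.
have dist_le i : `|l i - x i| <= e / #|I|.+1%:R.
  (* The coordinate is generalized again so that one [x] near the limit serves all coordinates: a
     finite intersection of members of [F] is in [F]. *)
  rewrite ltW // ffunE; move: i.
  near: x; apply: filter_forall => i.
  by move/cvgrPdist_lt: (cvgi i) => /(_ _ d0).
apply: (le_lt_trans (enorm_le_sum (l - x))).
apply: (@le_lt_trans _ _ (\sum_(i : I) e / #|I|.+1%:R)).
  by apply: ler_sum => i _; have := dist_le i; rewrite !ffunE.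
rewrite sumr_const -[_ *+ #|_|]mulr_natr mulrAC ltr_pdivrMr //.
by rewrite ltr_pM2l // ltr_nat.
Unshelve. all: by end_near. Qed.

HB.instance Definition _ :=
  Uniform_isComplete.Build (euclidean R I) euclidean_complete.

Fact edot_bilinear : bilinear_for *%R (idfun \; *%R) edot.
Proof. by split=> [z a x y|z a x y] /=; rewrite ?edotDZl ?edotDZr. Qed.

HB.instance Definition _ := bilinear_isBilinear.Build R (euclidean R I)
  (euclidean R I) R *%R (idfun \; *%R) edot edot_bilinear.

Fact edot_herm x y : edot x y = (-1) ^+ false * idfun (edot y x).
Proof. by rewrite expr0 mul1r edotC. Qed.

HB.instance Definition _ :=
  isHermitianSesquilinear.Build R (euclidean R I) false idfun edot edot_herm.

Fact edot_gt0 x : x != 0 -> 0 < edot x x.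
Proof.
rewrite lt_def edot_ge0 andbT; apply: contraNneq => /edot_eq0 ->; exact: eqxx.
Qed.

HB.instance Definition _ :=
  isDotProduct.Build R (euclidean R I) edot edot_gt0.

Definition euclidean_hilbert : hilbertSpace R :=
  @HilbertSpace R (euclidean R I) edot sqr_enorm.

End Euclidean.

(** The numbers [f i x] are the coordinates of the feature vector of [x], and the sum is the dot
    product of two such vectors. *)
Lemma finite_features_kernel (R : realType) (I : finType) (X : Type)
    (f : I -> X -> R) :
  is_kernel (fun x y => \sum_i f i x * f i y).
Proof.
exists (euclidean_hilbert R I), (fun x => [ffun i => f i x]) => x y.
by apply: eq_bigr => i _; rewrite !ffunE.
Qed.

Theorem theorem1 (R : realType) (V T Q C : nat)
    (hV : (1 <= V)%N) (hT : (1 <= T)%N) (hQ : (1 <= Q)%N) (hC : (2 <= C)%N)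
    (e : ensemble R V T Q C)
    (mask : 'M[R]_(V, T) -> 'M[bool]_(V, T)) :
  is_kernel (tck e mask).
Proof.
(* Features are indexed by dependent pairs of a model and one of its components, as the number of
   components varies with [q]. *)
pose f (p : {q : ens_index Q C & 'I_(ncomp q)}) X : R :=
  Pi e mask (tag p) X (tagged p) 0.
suff -> : tck e mask = fun X X' => \sum_p f p X * f p X'.
  exact: finite_features_kernel.
apply/funext => X; apply/funext => X'.
(* The sum over pairs is split into a sum over models of sums over components; each inner sum is the
   entry of a matrix product. *)
rewrite -(sig_big_dep xpredT (fun=> xpredT)
  (fun q g => Pi e mask q X g 0 * Pi e mask q X' g 0)).
by apply: eq_bigr => q _; rewrite mxE; apply: eq_bigr => g _; rewrite mxE.
Qed.
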